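(* Consider pairs of topological spaces $\langle X_1,\tau_1\rangle$, $\langle X_2,\tau_2\rangle$ for which there is a BCA-isomorphism $f$ of the algebras $\mathfrak{B}_1=\langle \mathrm{RC}(\tau_1),\mathsf{C}_{\tau_1}\rangle$ and $\mathfrak{B}_2=\langle \mathrm{RC}(\tau_2),\mathsf{C}_{\tau_2}\rangle$ that does not preserve interior-connectedness. Then the minimal number of points of the underlying spaces is five for one of the spaces and four for the other. That is: (i) for every such pair of spaces, each of $X_1$, $X_2$ has at least four points and at least one of $X_1$, $X_2$ has at least five points; and (ii) there exists such a pair of spaces in which one space has exactly five points and the other has exactly four points.
   Context: For a topological space $\langle X,\tau\rangle$ ($\tau$ the family of open sets), a subset $A\subseteq X$ is regular closed if $A=\overline{\operatorname{Int} A}$. $\mathrm{RC}(\tau)$ denotes the (complete) Boolean algebra of all regular closed subsets of $X$, ordered by inclusion, with join $A\cup D$, meet $A\cdot D=\overline{\operatorname{Int}(A\cap D)}$, complement $-A=\overline{X\setminus A}$, zero $\emptyset$ and unity $X$. The topological contact relation on $\mathrm{RC}(\tau)$ is defined by: $A\mathrel{\mathsf{C}_\tau} D$ if and only if $A\cap D\neq\emptyset$ (set-theoretical intersection). A BCA-isomorphism from $\langle B_1,\mathsf{C}_1\rangle$ to $\langle B_2,\mathsf{C}_2\rangle$ (Boolean algebras equipped with contact relations) is a Boolean algebra isomorphism $f\colon B_1\to B_2$ such that for all $x,y\in B_1$: $x\mathrel{\mathsf{C}_1}y$ if and only if $f(x)\mathrel{\mathsf{C}_2}f(y)$. A subset $A$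 of a topological space $X$ is interior-connected if its interior $\operatorname{Int} A$ is a connected subspace of $X$. A BCA-isomorphism $f\colon \mathrm{RC}(\tau_1)\to \mathrm{RC}(\tau_2)$ preserves interior-connectedness if for all $b\in \mathrm{RC}(\tau_1)$: $b$ has a connected interior in $X_1$ if and only if $f(b)$ has a connected interior in $X_2$. *)

(* Defs.v *)
From HB Require Import structures.
From mathcomp Require Import all_boot all_order.
From mathcomp Require Import boolp classical_sets functions cardinality.
From mathcomp Require Import topology.
Set Implicit Arguments.
Unset Strict Implicit.
Unset Printing Implicit Defensive.

Import Order.TTheory.
Local Open Scope classical_set_scope.

Lemma regclosed_closed (X : topologicalType) (A : set X) :
  regclosed A -> closed A.
Proof. by move=> <-; exact: closed_closure. Qed.

Lemma regclosed0 (X : topologicalType) : regclosed (@set0 X).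
Proof. by rewrite /regclosed interior0 closure0. Qed.

Lemma regclosedT (X : topologicalType) : regclosed (@setT X).
Proof. by rewrite /regclosed interiorT closureT. Qed.

Lemma regclosed_closure_interior (X : topologicalType) (A : set X) :
  regclosed (closure A°).
Proof. exact/closure_open_regclosed/open_interior. Qed.

Lemma regclosedU (X : topologicalType) (A B : set X) :
  regclosed A -> regclosed B -> regclosed (A `|` B).
Proof.
move=> rA rB; rewrite /regclosed eqEsubset; split.
  have /closure_id {2}-> : closed (A `|` B).
    by apply: closedU; exact: regclosed_closed.
  by apply: closureS; exact: interior_subset.
rewrite -{1}rA -{1}rB -closureU; apply: closureS; exact: interiorU.
Qed.

Lemma regclosed_closureC (X : topologicalType) (A : set X) :
  regclosed A -> regclosed (closure (~` A)).
Proof.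
by move=> /regclosed_closed cA; apply: closure_open_regclosed; rewrite openC.
Qed.

Lemma open_regclosedI (X : topologicalType) (O A C : set X) :
  open O -> O `<=` C -> regclosed A -> O `&` A `<=` closure (A `&` C)°.
Proof.
move=> oO OC rA x [Ox]; rewrite -{1}rA => Ax V Vx.
have /Ax[y [Ay [Oy Vy]]] : nbhs x (O `&` V).
  by apply: filterI => //; exact: open_nbhs_nbhs.
exists y; split => //; rewrite interiorI; split => //.
by apply: (interiorS OC); move/interior_id : oO => ->.
Qed.

(* Regularity is wrapped in `[< _ >] so that RC X is a subType of set X. *)
Record RC (X : topologicalType) : Type := MkRC {
  RC_set :> set X;
  RC_regclosed : `[< regclosed RC_set >] }.

HB.instance Definition _ (X : topologicalType) := [isSub for @RC_set X].
HB.instance Definition _ (X : topologicalType) := [Choice of RC X by <:].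

Lemma RC_regclosedP (X : topologicalType) (A : RC X) : regclosed A.
Proof. exact/asboolP/RC_regclosed. Qed.

Lemma RC_inj (X : topologicalType) (A B : RC X) : A = B :> set X -> A = B.
Proof. exact: val_inj. Qed.

Section RC_operations.
Context {X : topologicalType}.
Implicit Types A B : RC X.

Definition RC_le A B : bool := `[< A `<=` B >].
Definition RC_bot : RC X := MkRC (asboolT (@regclosed0 X)).
Definition RC_top : RC X := MkRC (asboolT (@regclosedT X)).
Definition RC_join A B : RC X :=
  MkRC (asboolT (regclosedU (RC_regclosedP A) (RC_regclosedP B))).
Definition RC_meet A B : RC X :=
  MkRC (asboolT (@regclosed_closure_interior X (A `&` B))).
Definition RC_compl A : RC X :=
  MkRC (asboolT (regclosed_closureC (RC_regclosedP A))).

Lemma RC_le_refl : reflexive RC_le.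
Proof. by move=> A; apply/asboolP. Qed.

Lemma RC_le_anti : antisymmetric RC_le.
Proof.
move=> A B /andP[/asboolP AB /asboolP BA]; apply: RC_inj.
by rewrite eqEsubset.
Qed.

Lemma RC_le_trans : transitive RC_le.
Proof.
move=> B A C /asboolP AB /asboolP BC; apply/asboolP.
exact: subset_trans BC.
Qed.

Lemma RC_meetP A B C : RC_le A (RC_meet B C) = RC_le A B && RC_le A C.
Proof.
apply/asboolP/andP => /= [ABC|[/asboolP AB /asboolP AC]].
  have BC : closure (B `&` C)° `<=` B `&` C.
    have /closure_id {2}-> : closed (B `&` C).
      by apply: closedI; apply: regclosed_closed; exact: RC_regclosedP.
    by apply: closureS; exact: interior_subset.
  by split; apply/asboolP => x /ABC /BC[].
rewrite -(RC_regclosedP A); apply: closureS; apply: interiorS.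
by rewrite subsetI.
Qed.

Lemma RC_joinP A B C : RC_le (RC_join A B) C = RC_le A C && RC_le B C.
Proof.
apply/asboolP/andP => /=; rewrite subUset => -[AC BC].
  by split; apply/asboolP.
by split; apply/asboolP.
Qed.

Lemma RC_le0x A : RC_le RC_bot A.
Proof. by apply/asboolP; exact: sub0set. Qed.

Lemma RC_lex1 A : RC_le A RC_top.
Proof. exact/asboolP. Qed.

Lemma RC_meetUl A B C :
  RC_meet (RC_join A B) C = RC_join (RC_meet A C) (RC_meet B C).
Proof.
apply: RC_inj => /=; rewrite eqEsubset; split.
  have /closure_id-> :
      closed (closure (A `&` C)° `|` closure (B `&` C)°).
    by apply: closedU; exact: closed_closure.
  apply: closureS => x ABCx.
  have IC : ((A `|` B) `&` C)° `<=` C by move=> y /interior_subset[].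
  have [[Ax|Bx] _] := interior_subset ABCx.
  - by left; apply: (open_regclosedI (@open_interior _ _) IC (RC_regclosedP A)).
  - by right; apply: (open_regclosedI (@open_interior _ _) IC (RC_regclosedP B)).
rewrite -closureU; apply: closureS => x [|]; apply: interiorS.
  by apply: setSI; exact: subsetUl.
by apply: setSI; exact: subsetUr.
Qed.

Lemma RC_joinxC A : RC_join A (RC_compl A) = RC_top.
Proof.
apply: RC_inj => /=; rewrite eqEsubset; split=> // x _.
have [Ax|nAx] := pselect ((A : set X) x); first by left.
by right; exact: subset_closure.
Qed.

Lemma RC_meetxC A : RC_meet A (RC_compl A) = RC_bot.
Proof.
apply: RC_inj => /=; rewrite closure_setC interiorI interiorC RC_regclosedP.
rewrite (_ : _ `&` _ = set0) ?closure0// -subset0 => x [].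
by move=> /interior_subset.
Qed.

End RC_operations.

Fact RC_display : Order.disp_t.
Proof. exact: Order.Disp tt tt. Qed.

HB.instance Definition _ (X : topologicalType) :=
  Order.Le_isPOrder.Build RC_display (RC X)
    (@RC_le_refl X) (@RC_le_anti X) (@RC_le_trans X).
HB.instance Definition _ (X : topologicalType) :=
  Order.POrder_MeetJoin_isLattice.Build RC_display (RC X)
    (@RC_meetP X) (@RC_joinP X).
HB.instance Definition _ (X : topologicalType) :=
  Order.Lattice_Meet_isDistrLattice.Build RC_display (RC X) (@RC_meetUl X).
HB.instance Definition _ (X : topologicalType) :=
  Order.hasBottom.Build RC_display (RC X) (@RC_le0x X).
HB.instance Definition _ (X : topologicalType) :=
  Order.hasTop.Build RC_display (RC X) (@RC_lex1 X).
HB.instance Definition _ (X : topologicalType) :=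
  Order.TBDistrLattice_hasComplement.Build RC_display (RC X)
    (@RC_joinxC X) (@RC_meetxC X).

Section RC_operationsE.
Context {X : topologicalType}.
Implicit Types A B : RC X.

Lemma RC_leE A B : (A <= B)%O = `[< (A : set X) `<=` B >].
Proof. by []. Qed.

Lemma RC_botE : (\bot : RC X)%O = set0 :> set X.
Proof. by []. Qed.

Lemma RC_topE : (\top : RC X)%O = setT :> set X.
Proof. by []. Qed.

Lemma RC_joinE A B : (A `|` B)%O = (A : set X) `|` B :> set X.
Proof. by []. Qed.

Lemma RC_meetE A B : (A `&` B)%O = closure ((A : set X) `&` B)° :> set X.
Proof. by []. Qed.

Lemma RC_complE A : (~` A)%O = closure (~` (A : set X)) :> set X.
Proof. by []. Qed.

End RC_operationsE.

Definition RC_contact (X : topologicalType) (A B : RC X) : Prop :=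
  (A : set X) `&` B !=set0.
Arguments RC_contact X A B : clear implicits.

Record BCA_isomorphism (d1 d2 : Order.disp_t)
    (B1 : ctbDistrLatticeType d1) (B2 : ctbDistrLatticeType d2)
    (C1 : B1 -> B1 -> Prop) (C2 : B2 -> B2 -> Prop) (f : B1 -> B2) : Prop := {
  BCA_bijective : bijective f;
  BCA_meet : forall x y, f (x `&` y)%O = (f x `&` f y)%O;
  BCA_join : forall x y, f (x `|` y)%O = (f x `|` f y)%O;
  BCA_compl : forall x, f (~` x)%O = (~` f x)%O;
  BCA_bot : f \bot%O = \bot%O;
  BCA_top : f \top%O = \top%O;
  BCA_contact : forall x y, C1 x y <-> C2 (f x) (f y) }.

Definition interior_connected (X : topologicalType) (A : set X) : Prop :=
  connected A°.

Definition preserves_interior_connectedness (X1 X2 : topologicalType)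
    (f : RC X1 -> RC X2) : Prop :=
  forall b : RC X1, interior_connected b <-> interior_connected (f b).

(* Main.v *)
Require Import Defs.
From HB Require Import structures.
From mathcomp Require Import all_boot all_order.
From mathcomp Require Import boolp classical_sets functions cardinality.
From mathcomp Require Import topology.
Local Open Scope classical_set_scope.
Local Open Scope card_scope.

Set Implicit Arguments.
Unset Strict Implicit.
Unset Printing Implicit Defensive.

Import Order.Theory.

(** Connectedness of an interior is read off from splittings: a regular closed
    set [b] has a connected interior exactly when, for every way of writing [b]
    as the join of two nonzero regular closed sets [c] and [d] with zero meet,
    some point of the interior of [b] belongs to both [c] and [d]
    ([interior_connectedP]).

    Lower bound ([interior_disconnected_card]). Suppose that [b] has a connected
    interior and [f b] does not. Some splitting of [f b] into [c2] and [d2] has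
    no common point inside the interior of [f b], whereas the corresponding
    splitting of [b] into [c1] and [d1] has a common point [p] inside the
    interior of [b]. So [c1] and [d1] are in contact, hence so are [c2] and
    [d2], at a point [q] which belongs to [f b] but not to its interior. This
    [q] lies on the complement of [f b] too; so [f b] is in contact with its
    complement, and [b] with its own, at a point [z]. On each side the parts of
    the splitting and the complement have three nonempty disjoint interiors;
    with [q] this makes four points on the side of [f b], and with [p] and [z]
    five points on the side of [b]. When it is [f b] that has a connected
    interior, the same applies to the inverse of [f].

    Extremal pair. Take three isolated points, together with a point whose only
    neighbourhood is the whole space: this is the four-point space. The
    five-point space has one more point, whose smallest neighbourhood consists
    of itself and two of the isolated points. In both spaces the isolated points
    are dense, so a regular closed set amounts to an arbitrary set of isolated
    points, and any two nonempty regular closed sets meet at the point without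
    proper neighbourhood ([trace_transfer_iso]). The regular closed set given by
    those two isolated points has a connected interior in the five-point space
    only. *)

(** * Counting points *)

Lemma uniq_card_ge (T : eqType) (s : seq T) : uniq s -> `I_(size s) #<= [set: T].
Proof.
case: s => [|x s] us; first by rewrite II0; exact: card_ge0.
have nth_inj : {in `I_(size (x :: s)) &, injective (nth x (x :: s))}.
  by move=> i j /set_mem /= ilt /set_mem /= jlt /eqP; rewrite nth_uniq// => /eqP.
by rewrite -(card_le_eql (inj_card_eq nth_inj)); exact: card_leT.
Qed.

Lemma card_setT_finType (T : finType) (n : nat) :
  #|T| = n -> [set: T] #= `I_n.
Proof.
move=> <-; rewrite (card_eqr card_II).
apply: card_eq_trans (card_eqxx _); rewrite card_eq_sym.
have -> : [set: 'I_#|T|] = enum_rank @` [set: T].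
  by apply/seteqP; split => // i _; exists (enum_val i) => //; rewrite enum_valK.
by apply: inj_card_eq => x y _ _; exact: enum_rank_inj.
Qed.

(** * Regular closed sets and connected interiors *)

Section regular_closed.
Context {X : topologicalType}.
Implicit Types (b c d : RC X) (x : X).

Lemma RC_closed b : closed (b : set X).
Proof. by apply: regclosed_closed; exact: RC_regclosedP. Qed.

Lemma RC_neq_bot_interior b : (b != \bot)%O -> (b : set X)° !=set0.
Proof.
move=> b0; apply/set0P; apply: contra b0 => /eqP bi0.
by apply/eqP/RC_inj; rewrite RC_botE -(RC_regclosedP b) bi0 closure0.
Qed.

Lemma RC_complP b x : RC_set (~` b)%O x <-> ~ (b : set X)° x.
Proof. by rewrite RC_complE closure_setC. Qed.

(** Zero meet in [RC X] is weaker than disjointness: the two sets may share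
    boundary points. *)
Lemma RC_disjP c d :
  (c `&` d = \bot)%O <-> (d : set X) `<=` ~` (c : set X)°.
Proof.
rewrite meetC -closure_setC -RC_complE; split=> [/eqP|dc].
  by rewrite disj_leC RC_leE => /asboolP.
by apply/eqP; rewrite disj_leC RC_leE; exact/asboolP.
Qed.

Lemma interior_connectedP b :
  interior_connected b <->
  forall c d, (c != \bot)%O -> (d != \bot)%O -> (c `|` d = b)%O ->
    (c `&` d = \bot)%O -> (b : set X)° `&` (c `&` d) !=set0.
Proof.
split=> [cb c d c0 d0 cdb cd0|H].
  have cib : (c : set X)° `<=` (b : set X)°.
    by apply: interiorS; rewrite -cdb; exact: subsetUl.
  have dib : (d : set X)° `<=` (b : set X)°.
    by apply: interiorS; rewrite -cdb; exact: subsetUr.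
  apply: contrapT => /nonemptyPn bcd0.
  suff bc : (b : set X)° `&` c = (b : set X)°.
    have [x dx] := RC_neq_bot_interior d0.
    move: (dib x dx); rewrite -bc => -[_ cx].
    by move: cd0; rewrite meetC => /RC_disjP /(_ _ cx); apply.
  (* Without a common point in the interior of [b], the part of [c] lying
     in that interior is both closed and open in it. *)
  apply: cb.
  - have [x cx] := RC_neq_bot_interior c0.
    by exists x; split; [exact: cib|exact: interior_subset].
  - exists (~` (d : set X)).
      by apply: closed_openC; exact: RC_closed.
    apply/seteqP; split=> x [bx].
      by move=> cx; split => // dx; have : set0 x by rewrite -bcd0.
    have : RC_set (c `|` d)%O x by rewrite cdb; exact: interior_subset.
    by rewrite RC_joinE => -[].
  - by exists (c : set X) => //; exact: RC_closed.
apply: contrapT => /connectedPn[E [E0 bE [sE sE']]].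
(* The two parts of a separation of an open set are open, so that their
   closures are regular closed and split [b]. *)
have oE0 : open (E false).
  have -> : E false = (b : set X)° `&` ~` closure (E true).
    rewrite bE; apply/seteqP; split=> x.
      by move=> Ex; split; [left|move=> cEx; have : set0 x by rewrite -sE'].
    by move=> [[//|Ex]] []; exact: subset_closure.
  by apply: openI; [exact: open_interior|exact/closed_openC/closed_closure].
have oE1 : open (E true).
  have -> : E true = (b : set X)° `&` ~` closure (E false).
    rewrite bE; apply/seteqP; split=> x.
      by move=> Ex; split; [right|move=> cEx; have : set0 x by rewrite -sE].
    by move=> [[Ex|//]] []; exact: subset_closure.
  by apply: openI; [exact: open_interior|exact/closed_openC/closed_closure].
pose c : RC X := MkRC (asboolT (closure_open_regclosed oE0)).
pose d : RC X := MkRC (asboolT (closure_open_regclosed oE1)).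
have neq0 (e : RC X) B : B `<=` e -> B !=set0 -> (e != \bot)%O.
  by move=> Be [x Bx]; apply/eqP => e0; move: (Be _ Bx); rewrite e0.
have [||||x [+ [cx dx]]] := H c d.
- exact: (neq0 c _ (@subset_closure _ _) (E0 false)).
- exact: (neq0 d _ (@subset_closure _ _) (E0 true)).
- by apply: RC_inj; rewrite RC_joinE /= -closureU -bE RC_regclosedP.
- rewrite meetC; apply/RC_disjP; rewrite -closure_setC; apply: closureS => x Ex dx.
  by have : set0 x by rewrite -sE'.
rewrite bE => -[Ex|Ex].
  by have : set0 x by rewrite -sE'.
by have : set0 x by rewrite -sE.
Qed.

End regular_closed.

(** * Contact isomorphisms and the lower bound *)

Lemma BCA_isomorphism_inv d1 d2 (B1 : ctbDistrLatticeType d1)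
    (B2 : ctbDistrLatticeType d2) (C1 : B1 -> B1 -> Prop)
    (C2 : B2 -> B2 -> Prop) (f : B1 -> B2) (g : B2 -> B1) :
  cancel f g -> cancel g f ->
  BCA_isomorphism C1 C2 f -> BCA_isomorphism C2 C1 g.
Proof.
move=> fK gK [_ fI fU fC f0 f1 fc].
have fi := can_inj fK.
split.
- by exists f.
- by move=> x y; apply: fi; rewrite fI !gK.
- by move=> x y; apply: fi; rewrite fU !gK.
- by move=> x; apply: fi; rewrite fC !gK.
- by apply: fi; rewrite gK f0.
- by apply: fi; rewrite gK f1.
- by move=> x y; rewrite fc !gK.
Qed.

(** One point from the interior of each of [c], [d] and the complement of [b];
    the last two clauses keep these points apart from contact points of [c] and
    [d], and of [b] and its complement. *)
Lemma RC_split_points (X : topologicalType) (b c d : RC X) :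
  (c != \bot)%O -> (d != \bot)%O -> (~` b != \bot)%O ->
  (c `|` d = b)%O -> (c `&` d = \bot)%O ->
  exists s : seq X, [/\ size s = 3, uniq s,
    forall x, RC_set c x -> RC_set d x -> x \notin s &
    forall x, RC_set b x -> RC_set (~` b)%O x -> x \notin s].
Proof.
move=> c0 d0 nb0 cdb cd0.
have [x1 x1i] := RC_neq_bot_interior c0.
have [x2 x2i] := RC_neq_bot_interior d0.
have [x3 x3i] := RC_neq_bot_interior nb0.
have cb : RC_set c `<=` b by rewrite -cdb; exact: subsetUl.
have db : RC_set d `<=` b by rewrite -cdb; exact: subsetUr.
have x1d : ~ RC_set d x1 by move=> /((RC_disjP _ _).1 cd0).
have x2c : ~ RC_set c x2.
  by move: cd0; rewrite meetC => cd0 /((RC_disjP _ _).1 cd0).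
have x3b : ~ RC_set b x3.
  by move: (meetCx b) => bnb /((RC_disjP _ _).1 bnb).
have x1nb : ~ RC_set (~` b)%O x1 by move=> /RC_complP; apply; exact: interiorS x1i.
have x2nb : ~ RC_set (~` b)%O x2 by move=> /RC_complP; apply; exact: interiorS x2i.
move: x1i x2i x3i => /interior_subset x1c /interior_subset x2d /interior_subset _.
have neq (A : set X) x y : A x -> ~ A y -> x != y.
  by move=> Ax nAy; apply/eqP => xy; apply: nAy; rewrite -xy.
exists [:: x1; x2; x3]; split => //.
- rewrite /= !inE negb_or (neq c x1 x2)// (neq b x1 x3) ?(neq b x2 x3)//.
    exact: db.
  exact: cb.
- move=> x cx dx; rewrite !inE !negb_or (neq d x x1)// (neq c x x2)//.
  by rewrite (neq b x x3)//; exact: cb.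
- move=> x bx nbx; rewrite !inE !negb_or (neq _ x x1 nbx)// (neq _ x x2 nbx)//.
  by rewrite (neq b x x3).
Qed.

Lemma interior_disconnected_card (X1 X2 : topologicalType)
    (f : RC X1 -> RC X2) (b : RC X1) :
  BCA_isomorphism (RC_contact X1) (RC_contact X2) f ->
  interior_connected b -> ~ interior_connected (f b) ->
  `I_5 #<= [set: X1] /\ `I_4 #<= [set: X2].
Proof.
move=> fiso cb /interior_connectedP ncfb.
have [g fK gK] := BCA_bijective fiso.
have giso := BCA_isomorphism_inv fK gK fiso.
have [c2 [d2 [c20 d20 cd2 cdI2 fbcd]]] : exists c d : RC X2,
    [/\ (c != \bot)%O, (d != \bot)%O, (c `|` d = f b)%O, (c `&` d = \bot)%O &
        (f b : set X2)° `&` ((c : set X2) `&` d) = set0].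
  apply: contrapT => H; apply: ncfb => c d c0 d0 cd cdI.
  by apply: contrapT => /nonemptyPn e; apply: H; exists c, d.
have g_neq0 x : (x != \bot)%O -> (g x != \bot)%O.
  by apply: contra => /eqP gx; rewrite -(gK x) gx (BCA_bot fiso).
have c10 := g_neq0 _ c20; have d10 := g_neq0 _ d20.
have cd1 : (g c2 `|` g d2 = b)%O by rewrite -(BCA_join giso) cd2 fK.
have cdI1 : (g c2 `&` g d2 = \bot)%O.
  by rewrite -(BCA_meet giso) cdI2 (BCA_bot giso).
move: (g c2) (g d2) c10 d10 cd1 cdI1 (BCA_contact giso c2 d2).
move=> c1 d1 c10 d10 cd1 cdI1 ccd.
have [p [bp [cp dp]]] := (interior_connectedP b).1 cb _ _ c10 d10 cd1 cdI1.
have [q [cq dq]] : RC_contact X2 c2 d2 by apply/ccd; exists p.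
have nbq : RC_set (~` f b)%O q.
  by apply/RC_complP => fbq; have : set0 q by rewrite -fbcd.
have [z [bz nbz]] : RC_contact X1 b (~` b)%O.
  apply/(BCA_contact fiso); rewrite (BCA_compl fiso); exists q; split => //.
  by rewrite -cd2 RC_joinE; left.
have nb0 : (~` b != \bot :> RC X1)%O.
  by apply/eqP => nb0; move: nbz; rewrite nb0.
have nfb0 : (~` f b != \bot :> RC X2)%O.
  by apply/eqP => nfb0; move: nbq; rewrite nfb0.
have [s1 [ss1 us1 cds1 bs1]] := RC_split_points c10 d10 nb0 cd1 cdI1.
have [s2 [ss2 us2 cds2 _]] := RC_split_points c20 d20 nfb0 cd2 cdI2.
split.
  have pz : p != z by apply/eqP => pz; move: nbz; rewrite -pz => /RC_complP.
  suff /uniq_card_ge : uniq [:: p, z & s1] by rewrite /= ss1.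
  by rewrite /= us1 andbT inE negb_or pz cds1 ?bs1.
suff /uniq_card_ge : uniq (q :: s2) by rewrite /= ss2.
by rewrite /= us2 cds2.
Qed.

(** * Spaces with a dense set of isolated points *)

(** The disjoint union of [I] and [J], in which the points of [I] are isolated
    and the smallest neighbourhood of [j : J] consists of [j] and of the set
    [N j] of points of [I]. *)
Definition cell_space (I J : Type) (N : J -> set I) : Type := (I + J)%type.

Section cell_space_topology.
Context {I J : choiceType} (N : J -> set I).
Local Notation T := (cell_space N).

HB.instance Definition _ := Choice.copy T (I + J)%type.

Definition cell_open : set_system T :=
  [set O | forall j, O (inr j) -> forall i, N j i -> O (inl i)].

Fact cell_openT : cell_open setT. Proof. by []. Qed.

Fact cell_openI : setI_closed cell_open.
Proof.
by move=> A B oA oB j [Aj Bj] i Ni; split; [exact: (oA j)|exact: (oB j)].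
Qed.

Fact cell_open_bigU (K : Type) (F : K -> set T) :
  (forall k, cell_open (F k)) -> cell_open (\bigcup_k F k).
Proof. by move=> oF j [k _ Fj] i Ni; exists k => //; exact: (oF k j). Qed.

HB.instance Definition _ :=
  isOpenTopological.Build T cell_openT cell_openI cell_open_bigU.

Lemma open_cellE (O : set T) : open O = cell_open O.
Proof. by []. Qed.

Lemma interior_inl (A : set T) i : A° (inl i) <-> A (inl i).
Proof.
split; first exact: interior_subset.
move=> Ai; rewrite /interior nbhsE; exists [set inl i]; last by move=> _ ->.
by split => // j.
Qed.

Lemma interior_inr (A : set T) j :
  A° (inr j) <-> A (inr j) /\ forall i, N j i -> A (inl i).
Proof.
split=> [Aj|[Aj NA]].
  split=> [|i Ni]; first exact: (interior_subset Aj).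
  by apply/interior_inl; exact: (@open_interior _ A j).
rewrite /interior nbhsE; exists [set x | x = inr j \/ exists2 i, N j i & x = inl i].
  split; last by left.
  by move=> k [[->]|[]//] i Ni; right; exists i.
by move=> _ [->|[i Ni ->]] //; exact: NA.
Qed.

Lemma closure_inl (A : set T) i : closure A (inl i) <-> A (inl i).
Proof.
rewrite -{1}[A]setCK closure_setC; split=> [H|Ai /interior_inl//].
by apply: contrapT => nAi; apply: H; exact/interior_inl.
Qed.

Lemma closure_inr (A : set T) j :
  closure A (inr j) <-> A (inr j) \/ exists2 i, N j i & A (inl i).
Proof.
rewrite -{1}[A]setCK closure_setC; split=> [H|[Aj|[i Ni Ai]] /interior_inr[]//].
  apply: contrapT => /not_orP[nAj nA]; apply: H; apply/interior_inr; split => //.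
  by move=> i Ni Ai; apply: nA; exists i.
by move=> _ /(_ i Ni).
Qed.

(** The set of isolated points contained in a regular closed set. *)
Definition trace (A : RC T) : set I := [set i | RC_set A (inl i)].

Lemma traceI (A B : RC T) : trace (A `&` B)%O = trace A `&` trace B.
Proof.
apply/seteqP; split=> i.
  by rewrite /trace /= => /closure_inl/interior_inl.
by move=> AB; apply/closure_inl/interior_inl.
Qed.

Lemma traceU (A B : RC T) : trace (A `|` B)%O = trace A `|` trace B.
Proof. by []. Qed.

Lemma traceC (A : RC T) : trace (~` A)%O = ~` trace A.
Proof.
apply/seteqP; split=> i; first by rewrite /trace /= => /closure_inl.
by move=> nAi; apply/closure_inl.
Qed.

Fact regclosed_closure_inl (S : set I) : regclosed (closure (inl @` S : set T)).
Proof. by apply: closure_open_regclosed; rewrite open_cellE => j []. Qed.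

(** The regular closed set with a given set of isolated points. *)
Definition of_trace (S : set I) : RC T := MkRC (asboolT (regclosed_closure_inl S)).

Lemma of_traceK : cancel of_trace trace.
Proof.
move=> S; apply/seteqP; split=> i; rewrite /trace /=.
  by move=> /closure_inl[k Sk [<-]].
by move=> Si; apply/closure_inl; exists i.
Qed.

(* Equivalently, the points of [I] are dense. *)
Hypothesis N_neq0 : forall j, N j !=set0.

Lemma RC_inr (A : RC T) j : RC_set A (inr j) <-> N j `&` trace A !=set0.
Proof.
rewrite -(RC_regclosedP A) closure_inr; split.
  move=> [/interior_inr[_ NA]|[i Ni /interior_inl Ai]]; last by exists i.
  by have [i Ni] := N_neq0 j; exists i; split => //; exact: NA.
by move=> [i [Ni Ai]]; right; exists i => //; exact/interior_inl.
Qed.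

Lemma traceK : cancel trace of_trace.
Proof.
have ti : injective trace.
  move=> A B AB; apply/RC_inj/seteqP.
  by split=> -[i|j]; rewrite ?RC_inr ?AB// => Ai;
    [have : trace A i by []; rewrite AB|have : trace B i by []; rewrite -AB].
by move=> A; apply: ti; rewrite of_traceK.
Qed.

(** If the smallest neighbourhood of some [j] contains all isolated points, [j]
    belongs to every nonempty regular closed set. *)
Lemma RC_contact_hub (A B : RC T) : (exists j, N j = setT) ->
  RC_contact T A B <-> trace A !=set0 /\ trace B !=set0.
Proof.
move=> [j Nj]; split=> [[[i|k]] []|[[a Aa] [b Bb]]].
- by split; exists i.
- by move=> /RC_inr[a [_ Aa]] /RC_inr[b [_ Bb]]; split; [exists a|exists b].
- by exists (inr j); split; apply/RC_inr; rewrite Nj setTI; [exists a|exists b].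
Qed.

Lemma trace_neq0 (A : RC T) : (A != \bot)%O -> trace A !=set0.
Proof.
move=> /RC_neq_bot_interior[[i|j]]; first by move=> /interior_subset; exists i.
by move=> /interior_subset/RC_inr[i [_ Ai]]; exists i.
Qed.

(** When [N j] is the trace of [A], the point [j] is interior to [A] and lies
    in both parts of any splitting of [A]. *)
Lemma interior_connected_trace (A : RC T) j : trace A = N j -> interior_connected A.
Proof.
move=> AN; apply/interior_connectedP => c d /trace_neq0[k ck] /trace_neq0[l dl] cdA _.
have kN : N j k by rewrite -AN -cdA traceU; left.
have lN : N j l by rewrite -AN -cdA traceU; right.
exists (inr j); split; last by split; apply/RC_inr; [exists k|exists l].
apply/interior_inr; split; last by move=> i; rewrite -AN.
by apply/RC_inr; exists k; rewrite AN.
Qed.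

Lemma interior_disconnected_trace (S1 S2 : set I) :
  S1 !=set0 -> S2 !=set0 -> S1 `&` S2 = set0 ->
  (forall j, ~ (N j `<=` S1 `|` S2)) ->
  ~ interior_connected (of_trace (S1 `|` S2)).
Proof.
move=> [i1 Si1] [i2 Si2] S0 NS /interior_connectedP.
have neq0 (S : set I) i : S i -> (of_trace S != \bot)%O.
  move=> Si; apply/eqP => S_bot.
  by have : trace (of_trace S) i; [rewrite of_traceK|rewrite S_bot].
move=> /(_ _ _ (neq0 _ _ Si1) (neq0 _ _ Si2)) [||[i|j] [bi [ci di]]].
- by apply: (can_inj traceK); rewrite traceU !of_traceK.
- apply: (can_inj traceK); rewrite traceI !of_traceK S0.
  by apply/seteqP; split=> i.
- have : (trace (of_trace S1) `&` trace (of_trace S2)) i by split.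
  by rewrite !of_traceK S0.
- have [_ Nj] := (interior_inr _ _).1 bi; apply: (NS j) => i /Nj.
  by rewrite -{2}(of_traceK (S1 `|` S2)).
Qed.

End cell_space_topology.

Section trace_transfer.
Context {I J1 J2 : choiceType} (N1 : J1 -> set I) (N2 : J2 -> set I).
Hypotheses (N1_neq0 : forall j, N1 j !=set0) (N2_neq0 : forall j, N2 j !=set0).
Hypotheses (N1_hub : exists j, N1 j = setT) (N2_hub : exists j, N2 j = setT).

(** The map sending a regular closed set to the one with the same isolated
    points in the other space. *)
Definition trace_transfer (A : RC (cell_space N1)) : RC (cell_space N2) :=
  of_trace N2 (trace A).

Lemma trace_transfer_iso :
  BCA_isomorphism (RC_contact (cell_space N1)) (RC_contact (cell_space N2))
    trace_transfer.
Proof.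
have t2i := can_inj (traceK N2_neq0).
have tr A : trace (trace_transfer A) = trace A by rewrite of_traceK.
split.
- exists (fun B => of_trace N1 (trace B)) => A.
    by rewrite tr traceK.
  by apply: t2i; rewrite tr of_traceK.
- by move=> A B; apply: t2i; rewrite tr !traceI !tr.
- by move=> A B; apply: t2i; rewrite tr !traceU !tr.
- by move=> A; apply: t2i; rewrite tr !traceC tr.
- by apply: t2i; rewrite tr.
- by apply: t2i; rewrite tr.
- by move=> A B; rewrite !RC_contact_hub// !tr.
Qed.

End trace_transfer.

(** * The extremal pair *)

(** The neighbourhoods defining the five-point space: the isolated points are
    the three elements of [option bool], the point [true] has the whole set of
    them in its smallest neighbourhood, and the point [false] all but [None]. *)
Definition five_nbhs (j : bool) : set (option bool) :=
  if j then setT else [set i | i != None].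

(** The four-point space: the same isolated points, and a single further point
    whose only neighbourhood is the whole space. *)
Definition four_nbhs (j : unit) : set (option bool) := setT.

Theorem theorem4p1 :
  (forall (X1 X2 : topologicalType) (f : RC X1 -> RC X2),
    BCA_isomorphism (RC_contact X1) (RC_contact X2) f ->
    ~ preserves_interior_connectedness f ->
    [/\ `I_4 #<= [set: X1], `I_4 #<= [set: X2] &
        `I_5 #<= [set: X1] \/ `I_5 #<= [set: X2]]) /\
  (exists (X1 X2 : topologicalType) (f : RC X1 -> RC X2),
    [/\ BCA_isomorphism (RC_contact X1) (RC_contact X2) f,
        ~ preserves_interior_connectedness f &
        ([set: X1] #= `I_5 /\ [set: X2] #= `I_4) \/
        ([set: X1] #= `I_4 /\ [set: X2] #= `I_5)]).
Proof.
split.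
  move=> X1 X2 f fiso /existsNP[b nb].
  have le45 (T : Type) : `I_5 #<= [set: T] -> `I_4 #<= [set: T].
    by apply: card_le_trans; rewrite card_le_II.
  have [cb|ncb] := pselect (interior_connected b).
    have ncfb : ~ interior_connected (f b) by move=> cfb; apply: nb.
    have [c5 c4] := interior_disconnected_card fiso cb ncfb.
    by split; [exact: le45|exact: c4|left].
  have cfb : interior_connected (f b).
    by apply: contrapT => ncfb; apply: nb; split.
  have [g fK gK] := BCA_bijective fiso.
  have giso := BCA_isomorphism_inv fK gK fiso.
  have [|c5 c4] := interior_disconnected_card giso cfb; first by rewrite fK.
  by split; [exact: c4|exact: le45|right].
have five0 j : five_nbhs j !=set0 by exists (Some true); case: j.
have four0 j : four_nbhs j !=set0 by exists None.
exists (cell_space five_nbhs), (cell_space four_nbhs).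
exists (@trace_transfer _ _ _ five_nbhs four_nbhs); split.
- by apply: trace_transfer_iso => //; [exists true|exists tt].
- pose S1 := [set Some true]; pose S2 := [set Some false].
  (* The isolated points other than [None] form the set [five_nbhs false],
     whereas [four_nbhs tt] is not included in them. *)
  move=> /(_ (of_trace five_nbhs (S1 `|` S2)))[+ _].
  rewrite /trace_transfer of_traceK => preserves.
  have /preserves : interior_connected (of_trace five_nbhs (S1 `|` S2)).
    apply: (interior_connected_trace five0 (j := false)).
    rewrite of_traceK; apply/seteqP; split=> [i [->|->]//|[[]|]//= _].
      by left.
    by right.
  apply: interior_disconnected_trace => //.
  + by exists (Some true).
  + by exists (Some false).
  + by apply/seteqP; split=> // i [-> ].
  + by move=> j /(_ None I)[].
- left; split.
    apply: (@card_setT_finType (option bool + bool)%type).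
    by rewrite card_sum card_option card_bool.
  apply: (@card_setT_finType (option bool + unit)%type).
  by rewrite card_sum card_option card_bool card_unit.
Qed.
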